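(* Let $p$ be a prime, let $m\ge 0$ be an integer, and let $(\mathbb{K},|\cdot|_{\mathbb{K}})$ be a valued field such that $\mathbb{Q}_p\subseteq\mathbb{K}$ (as a subfield) and the inclusion $\mathbb{Q}_p\hookrightarrow\mathbb{K}$ is continuous. For a continuous function $f:\mathbb{Q}_p\to\mathbb{K}$ define \[ \mathfrak{P}_m(f)=\{h\in\mathbb{Q}_p : \Delta_h^{m+1}f(x)=0 \text{ for all } x\in\mathbb{Q}_p\}. \] Then: (1) For every continuous $f:\mathbb{Q}_p\to\mathbb{K}$, either $\mathfrak{P}_m(f)=\{0\}$, or $\mathfrak{P}_m(f)=\mathbb{Q}_p$, or $\mathfrak{P}_m(f)=p^N\mathbb{Z}_p$ for a certain $N\in\mathbb{Z}$. (2) All these cases are attained: each of the sets $\{0\}$, $\mathbb{Q}_p$, and $p^N\mathbb{Z}_p$ ($N\in\mathbb{Z}$) equals $\mathfrak{P}_m(f)$ for some continuous $f:\mathbb{Q}_p\to\mathbb{K}$. (3) For every continuous $f:\mathbb{Q}_p\to\mathbb{K}$ and every $a\in\mathbb{Q}_p$ there exist constants $a_0,a_1,\dots,a_m\in\mathbb{K}$ (depending on $a$) such that $f(x)=a_0+a_1x+\cdots+a_mx^m$ for all $x\in a+\mathfrak{P}_m(f)$. (4) In particular, a continuous $f:\mathbb{Q}_p\to\mathbb{K}$ is a polynomial of degree $\le m$ (i.e. there are $a_0,\dots,a_m\in\mathbb{K}$ with $f(x)=a_0+a_1x+\cdots+a_mx^m$ for all $x\in\mathbb{Q}_p$) if and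 only if $\mathfrak{P}_m(f)$ contains an unbounded sequence.
   Context: $\mathbb{Q}_p$ is the field of $p$-adic numbers with its $p$-adic absolute value $|\cdot|_p$ and the induced topology, and $\mathbb{Z}_p=\{x\in\mathbb{Q}_p:|x|_p\le 1\}$. ''Unbounded'' refers to $|\cdot|_p$. A valued field is a field with an absolute value, carrying the induced topology. The difference operators are $\Delta_hf(x)=f(x+h)-f(x)$ and $\Delta_h^{n+1}f=\Delta_h(\Delta_h^nf)$, so $\Delta_h^{m+1}f(x)=\sum_{k=0}^{m+1}\binom{m+1}{k}(-1)^{m+1-k}f(x+kh)$. *)

(* Defs.v *)
From HB Require Import structures.
From mathcomp Require Import all_boot all_order all_algebra.
From mathcomp Require Import all_classical all_reals all_analysis.
From mathcomp Require Import ring_quotient.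
From mathcomp Require Import ring zify.

Set Implicit Arguments.
Unset Strict Implicit.
Unset Printing Implicit Defensive.

Import Order.TTheory GRing.Theory Num.Theory.
Import numFieldNormedType.Exports.

Local Open Scope classical_set_scope.
Local Open Scope ring_scope.

(* The norm of [normedZmodType] cannot be used as the absolute value: it obeys
   [`|x *+ n| = `|x| *+ n], hence it is never ultrametric. *)
HB.mixin Record Field_isValued (R : numFieldType) K & GRing.Field K := {
  absv : K -> R ;
  absv_ge0 : forall x, 0 <= absv x ;
  absv_eq0 : forall x, absv x = 0 <-> x = 0 ;
  absvM : forall x y, absv (x * y) = absv x * absv y ;
  absvD : forall x y, absv (x + y) <= absv x + absv y
}.

#[short(type="valuedFieldType")]
HB.structure Definition ValuedField (R : numFieldType) :=
  {K of GRing.Field K & Field_isValued R K}.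

Section ValuedFieldTopology.
Variables (R : numFieldType) (K : valuedFieldType R).
Implicit Types x y z : K.

Lemma absv0 : absv (0 : K) = 0 :> R.
Proof. exact/absv_eq0. Qed.

Lemma absv1 : absv (1 : K) = 1 :> R.
Proof.
have a0 : absv (1 : K) != 0 :> R by apply/eqP => /absv_eq0/eqP; rewrite oner_eq0.
by apply: (mulfI a0); rewrite -absvM !mulr1.
Qed.

Lemma absvN x : absv (- x) = absv x :> R.
Proof.
suff N1 : absv (-1 : K) = 1 :> R by rewrite -mulN1r absvM N1 mul1r.
have : absv (-1 : K) ^+ 2 == 1 :> R by rewrite expr2 -absvM mulrNN mulr1 absv1.
rewrite sqrf_eq1 => /orP[/eqP//|/eqP aN1].
by have := absv_ge0 (-1 : K); rewrite aN1 oppr_ge0 ler10.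
Qed.

Lemma absv_distxx x : absv (x - x) = 0 :> R.
Proof. by rewrite subrr absv0. Qed.

Lemma absv_dist_eq0 x y : absv (x - y) = 0 :> R -> x = y.
Proof. by move=> /absv_eq0/eqP; rewrite subr_eq0 => /eqP. Qed.

Lemma absv_distC x y : absv (x - y) = absv (y - x) :> R.
Proof. by rewrite -absvN opprB. Qed.

Lemma absv_dist_triangle y x z :
  absv (x - z) <= absv (x - y) + absv (y - z) :> R.
Proof. by rewrite -(subrKA y) absvD. Qed.

HB.instance Definition _ := isMetric.Build R K
  absv_distxx absv_dist_eq0 absv_distC absv_dist_triangle.

End ValuedFieldTopology.

Section PadicRat.
Variables (p : nat) (p_pr : prime p).

Definition padic_val_rat (q : rat) : int :=
  (logn p `|numq q|)%:Z - (logn p `|denq q|)%:Z.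

Definition padic_abs_rat (q : rat) : rat :=
  if q == 0 then 0 else p%:R ^ (- padic_val_rat q).

Lemma natr_p_gt0 : 0 < p%:R :> rat.
Proof. by rewrite ltr0n prime_gt0. Qed.

Lemma padic_val_frac (a b : int) : a != 0 -> b != 0 ->
  padic_val_rat (a%:~R / b%:~R) = (logn p `|a|)%:Z - (logn p `|b|)%:Z.
Proof.
move=> a0 b0; rewrite /padic_val_rat; set q : rat := _ / _.
have b0' : b%:~R != 0 :> rat by rewrite intr_eq0.
have q0 : q != 0 by rewrite mulf_neq0 ?invr_eq0 // intr_eq0.
have E : numq q * b = a * denq q.
  apply/eqP; rewrite -(eqr_int rat) !rmorphM /=; apply/eqP.
  have d0 : (denq q)%:~R != 0 :> rat by rewrite intr_eq0 denq_eq0.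
  have e1 : (numq q)%:~R = q * (denq q)%:~R by rewrite -{2}(divq_num_den q) divfK.
  by rewrite e1 /q mulrAC divfK.
have : logn p `|numq q * b| = logn p `|a * denq q| by rewrite E.
rewrite !abszM !lognM ?absz_gt0 ?numq_eq0 ?denq_eq0 //.
by lia.
Qed.

Lemma padic_abs_rat0 : padic_abs_rat 0 = 0.
Proof. by rewrite /padic_abs_rat eqxx. Qed.

Lemma padic_abs_rat_ge0 q : 0 <= padic_abs_rat q.
Proof. by rewrite /padic_abs_rat; case: ifP => // _; rewrite exprz_ge0 ?ltW ?natr_p_gt0. Qed.

Lemma padic_abs_rat_eq0 q : (padic_abs_rat q == 0) = (q == 0).
Proof.
rewrite /padic_abs_rat; case: ifP => [|q0]; first by rewrite eqxx.
by apply/negbTE; rewrite expfz_neq0 // gt_eqF ?natr_p_gt0.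
Qed.

Lemma padic_abs_ratM q r :
  padic_abs_rat (q * r) = padic_abs_rat q * padic_abs_rat r.
Proof.
rewrite /padic_abs_rat mulf_eq0.
case: (eqVneq q 0) => [_|q0] /=; first by rewrite mul0r.
case: (eqVneq r 0) => [_|r0] /=; first by rewrite mulr0.
rewrite -expfzDr ?gt_eqF ?natr_p_gt0 //; congr (_ ^ _); rewrite -opprD; congr (- _).
have -> : q * r = (numq q * numq r)%:~R / (denq q * denq r)%:~R.
  by rewrite -{1}(divq_num_den q) -{1}(divq_num_den r) mulf_div !rmorphM.
rewrite padic_val_frac ?mulf_neq0 ?numq_eq0 ?denq_eq0 //.
rewrite !abszM !lognM ?absz_gt0 ?numq_eq0 ?denq_eq0 // /padic_val_rat.
by lia.
Qed.

Lemma padic_abs_rat_ultra q r :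
  padic_abs_rat (q + r) <= Num.max (padic_abs_rat q) (padic_abs_rat r).
Proof.
case: (eqVneq q 0) => [->|q0].
  by rewrite add0r padic_abs_rat0 le_max lexx orbT.
case: (eqVneq r 0) => [->|r0].
  by rewrite addr0 padic_abs_rat0 le_max lexx.
case: (eqVneq (q + r) 0) => [->|qr0].
  by rewrite padic_abs_rat0 le_max padic_abs_rat_ge0.
pose a := numq q * denq r; pose b := numq r * denq q; pose d := denq q * denq r.
have d0 : d != 0 by rewrite mulf_neq0 ?denq_eq0.
have a0 : a != 0 by rewrite mulf_neq0 ?denq_eq0 ?numq_eq0.
have b0 : b != 0 by rewrite mulf_neq0 ?denq_eq0 ?numq_eq0.
have dq : (denq q)%:~R != 0 :> rat by rewrite intr_eq0 denq_eq0.
have dr : (denq r)%:~R != 0 :> rat by rewrite intr_eq0 denq_eq0.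
have qE : q = a%:~R / d%:~R.
  by rewrite -{1}(divq_num_den q) /a /d !rmorphM /=; field; rewrite dq dr.
have rE : r = b%:~R / d%:~R.
  by rewrite -{1}(divq_num_den r) /b /d !rmorphM /=; field; rewrite dq dr.
have sE : q + r = (a + b)%:~R / d%:~R by rewrite qE rE rmorphD mulrDl.
have ab0 : a + b != 0.
  by apply: contra_neq qr0 => ab; rewrite sE ab mul0r.
rewrite /padic_abs_rat (negPf q0) (negPf r0) (negPf qr0) sE {1}qE {1}rE.
rewrite !padic_val_frac // le_max.
have p1 : 1 < p%:R :> rat by rewrite ltr1n prime_gt1.
rewrite !ler_eXz2l //.
have key : (minn (logn p `|a|) (logn p `|b|) <= logn p `|(a + b)%R|)%N.
  set k := minn _ _.
  rewrite -pfactor_dvdn ?absz_gt0 //.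
  suff : ((p ^ k)%N %| a + b)%Z by [].
  rewrite rpredD //.
  - by rewrite dvdzE /= pfactor_dvdn ?absz_gt0 // geq_minl.
  - by rewrite dvdzE /= pfactor_dvdn ?absz_gt0 // geq_minr.
move: key; set x := logn _ _; set y := logn _ _; set z := logn _ _; set w := logn _ _.
by lia.
Qed.

End PadicRat.

Section PadicSequences.
Variables (p : nat) (p_pr : prime p).
Local Notation abs := (padic_abs_rat p).
Implicit Types (u v : nat -> rat) (q r : rat).

Definition padic_cauchy u : Prop :=
  forall e : rat, 0 < e -> exists N, forall i j,
    (N <= i)%N -> (N <= j)%N -> abs (u i - u j) < e.

Definition padic_null u : Prop :=
  forall e : rat, 0 < e -> exists N, forall i, (N <= i)%N -> abs (u i) < e.

Lemma padic_abs_ratD q r : abs (q + r) <= abs q + abs r.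
Proof.
apply: le_trans (padic_abs_rat_ultra p_pr q r) _.
by rewrite ge_max lerDl lerDr !padic_abs_rat_ge0.
Qed.

Lemma padic_abs_rat1 : abs 1 = 1.
Proof.
have a0 : abs 1 != 0 by rewrite padic_abs_rat_eq0.
by apply: (mulfI a0); rewrite -padic_abs_ratM // !mulr1.
Qed.

Lemma padic_abs_ratN q : abs (- q) = abs q.
Proof.
suff N1 : abs (-1) = 1 by rewrite -mulN1r padic_abs_ratM // N1 mul1r.
have : abs (-1) ^+ 2 == 1.
  by rewrite expr2 -padic_abs_ratM // mulrNN mulr1 padic_abs_rat1.
rewrite sqrf_eq1 => /orP[/eqP//|/eqP aN1].
by have := padic_abs_rat_ge0 p_pr (-1); rewrite aN1 oppr_ge0 ler10.
Qed.

Lemma padic_abs_ratV q : abs q^-1 = (abs q)^-1.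
Proof.
have [->|q0] := eqVneq q 0; first by rewrite !(padic_abs_rat0, invr0).
have a0 : abs q != 0 by rewrite padic_abs_rat_eq0.
by apply: (mulfI a0); rewrite -padic_abs_ratM // !divff // padic_abs_rat1.
Qed.

Lemma padic_abs_rat_distC q r : abs (q - r) = abs (r - q).
Proof. by rewrite -padic_abs_ratN opprB. Qed.

Lemma padic_abs_rat_dist q r : `|abs q - abs r| <= abs (q - r).
Proof.
rewrite ler_norml lerBrDr lerBlDr; apply/andP; split.
  have := padic_abs_ratD (r - q) q; rewrite subrK padic_abs_rat_distC.
  by rewrite addrC -lerBlDr addrC.
by have := padic_abs_ratD (q - r) r; rewrite subrK.
Qed.

Lemma padic_abs_rat_stable q r : abs (q - r) < abs r -> abs q = abs r.
Proof.
move=> qr; apply/eqP; rewrite eq_le; apply/andP; split.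
  have := padic_abs_rat_ultra p_pr (q - r) r; rewrite subrK.
  by rewrite max_r // ltW.
have := padic_abs_rat_ultra p_pr (r - q) q; rewrite subrK padic_abs_rat_distC.
rewrite le_max => /orP[|//].
by rewrite leNgt qr.
Qed.

Lemma padic_cauchy_bounded u : padic_cauchy u ->
  exists M, 0 < M /\ exists N, forall i, (N <= i)%N -> abs (u i) < M.
Proof.
move=> /(_ 1 ltr01)[N cu]; exists (abs (u N) + 1); split.
  by rewrite ltr_wpDl ?padic_abs_rat_ge0.
exists N => i Ni; rewrite -(subrK (u N) (u i)) addrC.
apply: le_lt_trans (padic_abs_ratD _ _) _.
by rewrite ltrD2l cu.
Qed.

Lemma padic_cauchy_away u : padic_cauchy u -> ~ padic_null u ->
  exists e : rat, 0 < e /\ exists N, forall i, (N <= i)%N -> e = abs (u i).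
Proof.
move=> cu /existsNP[e /not_implyP[e0 /forallNP nu]].
have [N cN] := cu e e0.
have /existsNP[k /not_implyP[Nk /negP]] := nu N; rewrite -leNgt => uk.
exists (abs (u k)); split; first exact: lt_le_trans uk.
exists N => i Ni; apply/esym/padic_abs_rat_stable.
by apply: lt_le_trans uk; exact: cN.
Qed.

Lemma padic_cauchy_cst q : padic_cauchy (fun=> q).
Proof. by move=> e e0; exists 0%N => i j _ _; rewrite subrr padic_abs_rat0. Qed.

Lemma padic_cauchyB u v :
  padic_cauchy u -> padic_cauchy v -> padic_cauchy (u - v).
Proof.
move=> cu cv e e0; have e2 : 0 < e / 2 by rewrite divr_gt0.
have [N cN] := cu _ e2; have [M cM] := cv _ e2.
exists (maxn N M) => i j; rewrite !geq_max => /andP[Ni Mi] /andP[Nj Mj].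
rewrite !fctE.
have -> : u i - v i - (u j - v j) = (u i - u j) + (v j - v i) by ring.
apply: le_lt_trans (padic_abs_ratD _ _) _; rewrite [X in _ < X]splitr.
by rewrite ltrD ?cN ?cM.
Qed.

Lemma padic_cauchyM u v :
  padic_cauchy u -> padic_cauchy v -> padic_cauchy (u * v).
Proof.
move=> cu cv e e0.
have [A [A0 [NA uA]]] := padic_cauchy_bounded cu.
have [B [B0 [NB vB]]] := padic_cauchy_bounded cv.
have eA : 0 < e / 2 / A by rewrite !divr_gt0.
have eB : 0 < e / 2 / B by rewrite !divr_gt0.
have [N cN] := cu _ eB; have [M cM] := cv _ eA.
exists (maxn (maxn NA NB) (maxn N M)) => i j.
rewrite !geq_max => /andP[/andP[ai bi] /andP[Ni Mi]].
move=> /andP[/andP[aj bj] /andP[Nj Mj]]; rewrite !fctE.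
have -> : u i * v i - u j * v j = u i * (v i - v j) + (u i - u j) * v j by ring.
apply: le_lt_trans (padic_abs_ratD _ _) _; rewrite !padic_abs_ratM //.
rewrite [X in _ < X]splitr ltrD //.
  rewrite -[X in _ < X](divfK (lt0r_neq0 A0)) mulrC.
  by rewrite ltr_pM ?padic_abs_rat_ge0 ?cM ?uA.
rewrite -[X in _ < X](divfK (lt0r_neq0 B0)).
by rewrite ltr_pM ?padic_abs_rat_ge0 ?cN ?vB.
Qed.

Lemma padic_nullD u v : padic_null u -> padic_null v -> padic_null (u + v).
Proof.
move=> nu nv e e0; have e2 : 0 < e / 2 by rewrite divr_gt0.
have [N nN] := nu _ e2; have [M nM] := nv _ e2.
exists (maxn N M) => i; rewrite geq_max => /andP[Ni Mi]; rewrite fctE.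
apply: le_lt_trans (padic_abs_ratD _ _) _.
by rewrite [X in _ < X]splitr ltrD ?nN ?nM.
Qed.

Lemma padic_nullM u v : padic_cauchy u -> padic_null v -> padic_null (u * v).
Proof.
move=> cu nv e e0; have [A [A0 [NA uA]]] := padic_cauchy_bounded cu.
have [N nN] := nv (e / A) (divr_gt0 e0 A0).
exists (maxn NA N) => i; rewrite geq_max => /andP[ai Ni]; rewrite fctE.
rewrite padic_abs_ratM // -[X in _ < X](divfK (lt0r_neq0 A0)) mulrC.
by rewrite ltr_pM ?padic_abs_rat_ge0 ?nN ?uA.
Qed.

Lemma padic_cauchyV u : padic_cauchy u -> ~ padic_null u ->
  padic_cauchy (fun n => (u n)^-1).
Proof.
move=> cu nu e e0; have [d [d0 [N dN]]] := padic_cauchy_away cu nu.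
have [M cM] := cu (e * d ^+ 2) (mulr_gt0 e0 (exprn_gt0 2 d0)).
exists (maxn N M) => i j; rewrite !geq_max => /andP[Ni Mi] /andP[Nj Mj].
have nz k : (N <= k)%N -> u k != 0.
  by move=> Nk; rewrite -(padic_abs_rat_eq0 p_pr) -dN // gt_eqF.
have -> : (u i)^-1 - (u j)^-1 = (u j - u i) * (u i)^-1 * (u j)^-1.
  by field; rewrite !nz.
rewrite !padic_abs_ratM // !padic_abs_ratV -!dN // -mulrA -expr2 exprVn.
by rewrite ltr_pdivrMr ?exprn_gt0 // cM.
Qed.

Lemma padic_abs_cvg u : padic_cauchy u ->
  cvgn (fun n => (abs (u n) : rat^o)).
Proof.
move=> cu; have [nu|nu] := pselect (padic_null u).
  apply/cvg_ex; exists (0 : rat^o); apply/cvgrPdist_lt => e e0.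
  have [N nN] := nu e e0; exists N => //= n Nn.
  by rewrite sub0r normrN ger0_norm ?padic_abs_rat_ge0 ?nN.
have [d [d0 [N dN]]] := padic_cauchy_away cu nu.
apply/cvg_ex; exists (d : rat^o); apply/cvgrPdist_lt => e e0.
by exists N => //= n Nn; rewrite -dN // subrr normr0.
Qed.

Lemma padic_abs_lim_null u v : padic_cauchy u -> padic_null (v - u) ->
  limn (fun n => (abs (v n) : rat^o)) = limn (fun n => (abs (u n) : rat^o)).
Proof.
move=> /padic_abs_cvg cu nvu; apply: cvg_lim => //.
move/cvgrPdist_lt : cu => cu; apply/cvgrPdist_lt => e e0.
have e2 : 0 < e / 2 by rewrite divr_gt0.
have [N _ uN] := cu _ e2; have [M nM] := nvu _ e2.
exists (maxn N M) => //= n /=; rewrite geq_max => /andP[Nn Mn].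
rewrite -(subrKA (abs (u n))) (le_lt_trans (ler_normD _ _)) //.
rewrite [X in _ < X]splitr ltrD //; first exact: uN.
rewrite distrC; apply: le_lt_trans (padic_abs_rat_dist _ _) _.
exact: nM.
Qed.

End PadicSequences.

Record padic_seq (p : nat) (p_pr : prime p) := PadicSeq {
  padic_seqval :> nat -> rat ;
  padic_seqP : `[< padic_cauchy p padic_seqval >]
}.

Section PadicRing.
Variables (p : nat) (p_pr : prime p).
Local Notation seqs := (padic_seq p_pr).

HB.instance Definition _ := [isSub for @padic_seqval p p_pr].
HB.instance Definition _ := [Choice of seqs by <:].

Lemma padic_seq_cauchy (u : seqs) : padic_cauchy p u.
Proof. exact/asboolP/padic_seqP. Qed.

Lemma padic_cauchy_subring :
  subring_closed [pred u : nat -> rat | `[< padic_cauchy p u >]].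
Proof.
split.
- by apply/asboolP; exact: padic_cauchy_cst.
- move=> u v /asboolP cu /asboolP cv; apply/asboolP; exact: padic_cauchyB.
- move=> u v /asboolP cu /asboolP cv; apply/asboolP; exact: padic_cauchyM.
Qed.

HB.instance Definition _ := GRing.SubChoice_isSubComNzRing.Build
  (nat -> rat) _ seqs padic_cauchy_subring.

Definition padic_null_ideal : {pred seqs} :=
  fun u : seqs => `[< padic_null p u >].

Lemma padic_null_idealr_closed : idealr_closed padic_null_ideal.
Proof.
split.
- by apply/asboolP => e e0; exists 0%N => i _; rewrite /= padic_abs_rat0.
- apply/negP => /asboolP /(_ 1 ltr01)[N /(_ N (leqnn N))].
  by rewrite /= padic_abs_rat1 // ltxx.
- move=> a u v /asboolP nu /asboolP nv; apply/asboolP.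
  by apply: padic_nullD => //; apply: padic_nullM => //; exact: padic_seq_cauchy.
Qed.

HB.instance Definition _ :=
  isIdealr.Build seqs padic_null_ideal padic_null_idealr_closed.

End PadicRing.

(* The field of p-adic numbers, as Cauchy sequences of rationals modulo null
   sequences. *)
Definition Qp (p : nat) (p_pr : prime p) : Type :=
  {ideal_quot (padic_null_ideal (p_pr := p_pr))}.

Section PadicField.
Variables (p : nat) (p_pr : prime p).
Local Notation Qp := (Qp p_pr).
Local Notation seqs := (padic_seq p_pr).
Local Notation limabs u :=
  (limn (fun n => (padic_abs_rat p (padic_seqval u n) : rat^o))).

HB.instance Definition _ := GRing.ComNzRing.on Qp.
HB.instance Definition _ := EqQuotient.on Qp.
HB.instance Definition _ := NzRingQuotient.on Qp.

Lemma Qp_eq (u v : seqs) :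
  (\pi_Qp u = \pi_Qp v)%qT <-> padic_null p (padic_seqval u - padic_seqval v).
Proof.
have E := Quotient.idealrBE (padic_null_ideal (p_pr := p_pr)) u v.
by split=> [/eqP|nuv]; [rewrite -E => /asboolP|apply/eqP; rewrite -E; apply/asboolP].
Qed.

Lemma Qp_pi0 : (\pi_Qp (0 : seqs))%qT = 0. Proof. exact: pi_zeror. Qed.

Lemma Qp_pi1 : (\pi_Qp (1 : seqs))%qT = 1. Proof. exact: pi_oner. Qed.

Lemma Qp_piD (u v : seqs) : (\pi_Qp (u + v) = \pi_Qp u + \pi_Qp v :> Qp)%qT.
Proof. exact: pi_addr. Qed.

Lemma Qp_piM (u v : seqs) : (\pi_Qp (u * v) = \pi_Qp u * \pi_Qp v :> Qp)%qT.
Proof. exact: pi_mulr. Qed.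

Lemma Qp_inv_subproof (x : Qp) : x != 0 -> exists y, y * x == 1.
Proof.
rewrite -[x]reprK -[0]Qp_pi0; set u := repr x => /eqP un0.
have cu := padic_seq_cauchy u.
have nu : ~ padic_null p (padic_seqval u).
  by move=> nu; apply: un0; apply/Qp_eq; rewrite subr0.
pose v : seqs := PadicSeq p_pr (asboolT (padic_cauchyV p_pr cu nu)).
exists (\pi_Qp v)%qT; apply/eqP.
rewrite -Qp_piM -Qp_pi1; apply/Qp_eq => e e0.
have [d [d0 [N dN]]] := padic_cauchy_away p_pr cu nu.
exists N => i Ni; rewrite /= !fctE /= mulVf ?subrr ?padic_abs_rat0 //.
by rewrite -(padic_abs_rat_eq0 p_pr) -dN // gt_eqF.
Qed.

Definition Qp_inv (x : Qp) : Qp :=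
  if pselect (exists y, y * x == 1) is left ex then xchoose ex else 0.

Lemma Qp_mulVf (x : Qp) : x != 0 -> Qp_inv x * x = 1.
Proof.
move=> /Qp_inv_subproof ex; rewrite /Qp_inv; case: pselect => // ex'.
exact/eqP/(xchooseP ex').
Qed.

Lemma Qp_inv0 : Qp_inv 0 = 0.
Proof.
rewrite /Qp_inv; case: pselect => // ex; exfalso; case: ex => y.
by rewrite mulr0 eq_sym (negPf (oner_neq0 _)).
Qed.

HB.instance Definition _ := GRing.ComNzRing_isField.Build Qp Qp_mulVf Qp_inv0.

(* Absolute values of p-adic numbers are powers of p or 0, hence rational: the
   limit is taken in [rat] with its usual distance. *)
Definition Qp_abs (x : Qp) : rat := limabs (repr x).

Lemma Qp_abs_pi (u : seqs) : Qp_abs (\pi_Qp u)%qT = limabs u.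
Proof.
apply: padic_abs_lim_null => //; first exact: padic_seq_cauchy.
by apply/Qp_eq; rewrite reprK.
Qed.

Lemma Qp_abs_cvg (u : seqs) :
  (padic_abs_rat p (padic_seqval u n) : rat^o) @[n --> \oo]
    --> (Qp_abs (\pi_Qp u)%qT : rat^o).
Proof. by rewrite Qp_abs_pi; apply: padic_abs_cvg => //; exact: padic_seq_cauchy. Qed.

Arguments Qp_abs_cvg : clear implicits.

Lemma Qp_abs_ge0 (x : Qp) : 0 <= Qp_abs x.
Proof.
apply: limr_ge; first by apply: padic_abs_cvg => //; exact: padic_seq_cauchy.
by apply: nearW => n; exact: padic_abs_rat_ge0.
Qed.

Lemma Qp_abs_eq0 (x : Qp) : Qp_abs x = 0 <-> x = 0.
Proof.
rewrite -[x]reprK -[X in _ <-> _ = X]Qp_pi0; set u := repr x; split=> [au|/Qp_eq nu].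
  have := Qp_abs_cvg u; rewrite au => /cvgrPdist_lt au0.
  apply/Qp_eq => e e0; have [N _ aN] := au0 e e0.
  exists N => i Ni; rewrite subr0; have := aN i Ni.
  by rewrite sub0r normrN ger0_norm // padic_abs_rat_ge0.
rewrite Qp_abs_pi; apply: (@cvg_lim rat^o) => //; apply/cvgrPdist_lt => e e0.
have [N nN] := nu e e0; exists N => //= i Ni.
by rewrite sub0r normrN ger0_norm ?padic_abs_rat_ge0 //; have := nN i Ni; rewrite subr0.
Qed.

Lemma Qp_absM (x y : Qp) : Qp_abs (x * y) = Qp_abs x * Qp_abs y.
Proof.
rewrite -[x]reprK -[y]reprK -Qp_piM.
set u := repr x; set v := repr y.
rewrite [LHS]Qp_abs_pi; apply: (@cvg_lim rat^o) => //.
under eq_fun do rewrite /= fctE padic_abs_ratM //.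
exact: cvgM (Qp_abs_cvg u) (Qp_abs_cvg v).
Qed.

Lemma Qp_absD (x y : Qp) : Qp_abs (x + y) <= Qp_abs x + Qp_abs y.
Proof.
rewrite -[x]reprK -[y]reprK -Qp_piD.
set u := repr x; set v := repr y.
apply: (ler_cvg_to (Qp_abs_cvg (u + v)) (cvgD (Qp_abs_cvg u) (Qp_abs_cvg v))).
by apply: nearW => n; exact: padic_abs_ratD.
Qed.

HB.instance Definition _ :=
  Field_isValued.Build rat Qp Qp_abs_ge0 Qp_abs_eq0 Qp_absM Qp_absD.

HB.instance Definition _ := Metric.copy Qp (Qp : valuedFieldType rat).

Definition Qp_of_rat (q : rat) : Qp :=
  (\pi_Qp (PadicSeq p_pr (asboolT (@padic_cauchy_cst p q))))%qT.

Lemma Qp_of_rat_is_zmod_morphism : zmod_morphism Qp_of_rat.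
Proof.
move=> q r; rewrite /Qp_of_rat; set u := PadicSeq _ _; set v := PadicSeq _ _.
set w := PadicSeq _ _; suff -> : u = v - w by exact: (raddfB (\pi_Qp)%qT).
exact: val_inj.
Qed.

Lemma Qp_of_rat_is_monoid_morphism : monoid_morphism Qp_of_rat.
Proof.
split=> [|q r]; first by rewrite -Qp_pi1; congr (\pi_Qp _)%qT; exact: val_inj.
by rewrite /Qp_of_rat -Qp_piM; congr (\pi_Qp _)%qT; exact: val_inj.
Qed.

HB.instance Definition _ :=
  GRing.isZmodMorphism.Build rat Qp Qp_of_rat Qp_of_rat_is_zmod_morphism.
HB.instance Definition _ :=
  GRing.isMonoidMorphism.Build rat Qp Qp_of_rat Qp_of_rat_is_monoid_morphism.

Lemma absv_ratr (q : rat) : absv (ratr q : Qp) = padic_abs_rat p q.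
Proof.
rewrite -(fmorph_eq_rat Qp_of_rat) [LHS]Qp_abs_pi /=.
exact: (@lim_cst rat^o).
Qed.

End PadicField.

Definition Zp_in_Qp (p : nat) (p_pr : prime p) : set (Qp p_pr) :=
  [set x | absv x <= 1].

Arguments Zp_in_Qp {p} p_pr _.

Definition fdiff (U V : zmodType) (h : U) (f : U -> V) : U -> V :=
  fun x => f (x + h) - f x.

Definition poly_periods (p : nat) (p_pr : prime p) (V : zmodType) (m : nat)
    (f : Qp p_pr -> V) : set (Qp p_pr) :=
  [set h | forall x, iter m.+1 (fdiff h) f x = 0].

(* Main.v *)
(* If Delta_h^(m+1) f = 0, Newton's forward formula makes n |-> f (x + n h) a
   polynomial of degree <= m in n; as the naturals are dense in Z_p and f is
   continuous, f (x + h z) is a polynomial of degree <= m in z for z in Z_p, so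
   that every h z is a period too. Hence the set of periods is stable under Z_p;
   the p-adic absolute value being discrete, it is {0}, a ball p^N Z_p or Q_p.
   The polynomials obtained for different h agree on an infinite set, so they
   coincide, which gives the polynomial on the whole coset. The three cases are
   attained by x^(m+1), 0 and the indicator functions of the balls. *)
Require Import Defs.
From mathcomp Require Import all_boot all_order all_algebra.
From mathcomp Require Import all_classical all_reals all_analysis.
From mathcomp Require Import ring lra zify.

Set Implicit Arguments.
Unset Strict Implicit.
Unset Printing Implicit Defensive.

Import Order.TTheory GRing.Theory Num.Theory.
Import numFieldNormedType.Exports.

Local Open Scope classical_set_scope.
Local Open Scope ring_scope.

(** * Approximation in [Qp], the ultrametric inequality and the value group *)

Section PadicAbs.
Variables (p : nat) (p_pr : prime p).
Local Notation Qp := (Qp p_pr).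
Implicit Types (x y : Qp) (e : rat).

Lemma padic_abs_rat_int_le (k : nat) (a : int) :
  ((p ^ k)%N %| a)%Z -> padic_abs_rat p a%:~R <= p%:R ^- k.
Proof.
rewrite /padic_abs_rat; case: ifP => [_ _|].
  by rewrite invr_ge0 exprn_ge0.
rewrite intr_eq0 => /negbT a0 dva; rewrite exprnN ler_eXz2l ?ltr1n ?prime_gt1 //.
rewrite -[a%:~R]divr1 -[1]/(1%:~R) padic_val_frac // logn1.
have : (k <= logn p `|a|)%N by rewrite -pfactor_dvdn ?absz_gt0.
by lia.
Qed.

Lemma prime_expV_lt e : 0 < e -> exists k : nat, p%:R ^- k < e.
Proof.
move=> e0; have p1 : `|p%:R^-1 : rat| < 1.
  by rewrite ger0_norm // invf_lt1 ?ltr1n ?prime_gt1 ?ltr0n ?prime_gt0.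
have /cvgrPdist_lt /(_ e e0) [k _ kP] := cvg_expr p1.
exists k; have := kP k (leqnn k).
by rewrite /= sub0r normrN exprVn ger0_norm // invr_ge0 exprn_ge0.
Qed.

(** A p-integral rational has a denominator prime to p, hence invertible modulo [p ^ k] by Bezout;
    the natural number is the numerator times that inverse, reduced modulo [p ^ k]. *)
Lemma padic_rat_approx_nat (q e : rat) : padic_abs_rat p q <= 1 -> 0 < e ->
  exists n : nat, padic_abs_rat p (q - n%:R) < e.
Proof.
move=> q1 e0; have [k ke] := prime_expV_lt e0.
have [->|q0] := eqVneq q 0; first by exists 0%N; rewrite subr0 padic_abs_rat0.
have pd : coprime p `|denq q|.
  rewrite prime_coprime //; apply/negP => pd.
  have pn : ~~ (p %| `|numq q|)%N.
    apply/negP => pn; have := coprime_num_den q; rewrite /coprime => /eqP gE.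
    have := prime_gt1 p_pr; rewrite ltnNge => /negP; apply.
    by apply: dvdn_leq => //; rewrite -gE dvdn_gcd pn pd.
  move: q1; rewrite /padic_abs_rat (negPf q0) -[X in _ <= X](expr0z p%:R).
  rewrite ler_eXz2l ?ltr1n ?prime_gt1 // /padic_val_rat.
  have : (0 < logn p `|denq q|)%N.
    by rewrite logn_gt0 mem_primes p_pr absz_gt0 denq_eq0.
  by rewrite (@logn_coprime p `|numq q|) ?prime_coprime //; lia.
have [u [v uv]] := Bezoutz (p ^ k)%N (denq q).
have {uv} uv : u * (p ^ k)%N%:Z + v * denq q = 1.
  by rewrite uv; apply/eqP; rewrite -[_ == _]/(coprimez _ _) coprimezE coprimeXl.
pose n := (numq q * v %% (p ^ k)%N)%Z.
have pk0 : (p ^ k)%N%:Z != 0 by rewrite eqz_nat expn_eq0 negb_and -lt0n prime_gt0.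
exists `|n|%N; apply: le_lt_trans ke.
have nE : `|n|%N = n :> int by rewrite gez0_abs // modz_ge0.
have dq : (denq q)%:~R != 0 :> rat by rewrite intr_eq0 denq_eq0.
have -> : q - `|n|%N%:R = (numq q - n * denq q)%:~R / (denq q)%:~R.
  by rewrite -{1}(divq_num_den q) rmorphB rmorphM /= -nE; field.
rewrite padic_abs_ratM // padic_abs_ratV //.
have -> : padic_abs_rat p (denq q)%:~R = 1.
  rewrite /padic_abs_rat intr_eq0 (negPf (denq_neq0 q)) -[_%:~R]divr1.
  by rewrite -[1]/(1%:~R) padic_val_frac ?denq_neq0 // logn1 logn_coprime.
rewrite invr1 mulr1; apply: padic_abs_rat_int_le.
have -> : numq q - n * denq q =
    (numq q * u + (numq q * v %/ (p ^ k)%N)%Z * denq q) * (p ^ k)%N%:Z.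
  have nv : n = numq q * v - (numq q * v %/ (p ^ k)%N)%Z * (p ^ k)%N%:Z.
    by rewrite {1}(divz_eq (numq q * v) (p ^ k)%N) addrC addKr.
  by rewrite nv -{1}[numq q]mulr1 -uv; ring.
exact: dvdz_mull.
Qed.

Lemma absv_Qp_of_rat (q : rat) : absv (Qp_of_rat p_pr q) = padic_abs_rat p q.
Proof. by rewrite (fmorph_eq_rat (@Qp_of_rat p p_pr)) absv_ratr. Qed.

Lemma Qp_rat_dense x e : 0 < e ->
  exists q : rat, absv (x - Qp_of_rat p_pr q) < e.
Proof.
move=> e0; have e2 : 0 < e / 2 by rewrite divr_gt0.
have [N cN] := padic_seq_cauchy (repr x) e2.
exists (repr x N); rewrite -{1}[x]reprK; set q := repr x N.
pose v : padic_seq p_pr := PadicSeq p_pr (asboolT (@padic_cauchy_cst p q)).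
have -> : (\pi_Qp (repr x))%qT - Qp_of_rat p_pr q = (\pi_Qp (repr x - v))%qT.
  by rewrite (raddfB (\pi_Qp)%qT).
(* Passing to the limit only preserves weak inequalities, hence the Cauchy bound with [e / 2]. *)
apply: (@le_lt_trans _ _ (e / 2)); last by rewrite ltr_pdivrMr // ltr_pMr // ltr1n.
rewrite /absv /= Qp_abs_pi; apply: limr_le.
  by apply: padic_abs_cvg => //; exact: padic_seq_cauchy.
by exists N => // n /= Nn; apply/ltW; exact: cN.
Qed.

(** The inequality passes from the rationals by density: approximating [x] and [y] within [e / 4]
    costs three such errors in all, and [e] is arbitrary. *)
Lemma Qp_ultra x y : absv (x + y) <= Num.max (absv x) (absv y).
Proof.
apply/ler_addgt0Pr => e e0; rewrite -lerBlDr le_max; have e4 : 0 < e / 4 by rewrite divr_gt0.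
have [q qx] := Qp_rat_dense x e4; have [r ry] := Qp_rat_dense y e4.
have xyE : x + y = (x - Qp_of_rat p_pr q) + (y - Qp_of_rat p_pr r)
    + Qp_of_rat p_pr (q + r) by rewrite rmorphD /=; ring.
have near (z : Qp) s : absv (Qp_of_rat p_pr s) <= absv z + absv (z - Qp_of_rat p_pr s).
  by rewrite -(absvN (z - _)) opprB; apply: le_trans (absvD _ _); rewrite addrC subrK.
have := padic_abs_rat_ultra p_pr q r; rewrite -!absv_Qp_of_rat => qr.
have := absvD (x - Qp_of_rat p_pr q + (y - Qp_of_rat p_pr r)) (Qp_of_rat p_pr (q + r)).
rewrite -xyE.
have := absvD (x - Qp_of_rat p_pr q) (y - Qp_of_rat p_pr r).
have := near x q; have := near y r.
by move: qr; rewrite le_max => /orP[] h1 h2 h3 h4 h5; apply/orP; [left|right]; lra.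
Qed.

Lemma Qp_ultra_le x y e : absv x <= e -> absv y <= e -> absv (x + y) <= e.
Proof. by move=> xe ye; apply: le_trans (Qp_ultra x y) _; rewrite ge_max xe ye. Qed.

Lemma Qp_ultra_lt x y e : absv x < e -> absv y < e -> absv (x + y) < e.
Proof. by move=> xe ye; apply: le_lt_trans (Qp_ultra x y) _; rewrite gt_max xe ye. Qed.

Lemma absv_Qp_natp : absv (p%:R : Qp) = p%:R^-1 :> rat.
Proof.
rewrite -(rmorph_nat (Qp_of_rat p_pr)) absv_Qp_of_rat /padic_abs_rat.
rewrite pnatr_eq0 (negPf (lt0n_neq0 (prime_gt0 p_pr))).
have -> : (p%:R : rat) = p%:Z%:~R / 1%:~R by rewrite divr1.
rewrite padic_val_frac //; last by rewrite eqz_nat lt0n_neq0 ?prime_gt0.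
by rewrite logn1 subr0 absz_nat logn_prime // eqxx divr1.
Qed.

Lemma Qp_natp_neq0 : (p%:R : Qp) != 0.
Proof.
apply/eqP => /absv_eq0; rewrite absv_Qp_natp => /eqP.
by rewrite invr_eq0 pnatr_eq0 (negPf (lt0n_neq0 (prime_gt0 p_pr))).
Qed.

Lemma absv_Qp_expz (N : int) : absv (p%:R ^ N : Qp) = p%:R ^ (- N) :> rat.
Proof.
have expn (n : nat) : absv (p%:R ^+ n : Qp) = p%:R ^- n :> rat.
  elim: n => [|n IH]; first by rewrite !expr0 absv1 invr1.
  by rewrite !exprS absvM IH absv_Qp_natp invfM.
case: N => n; first by rewrite -exprnP expn exprnN.
rewrite NegzE opprK -exprnN -exprnP.
have := absvM (p%:R ^+ n.+1 : Qp) (p%:R ^- n.+1).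
rewrite mulfV ?expf_neq0 ?Qp_natp_neq0 // absv1 expn => /esym.
move/(canRL (mulVKf _)) => -> //; last first.
  by rewrite expf_neq0 // pnatr_eq0 lt0n_neq0 ?prime_gt0.
by rewrite mulr1.
Qed.

(** By the ultrametric inequality, a rational whose distance to [x] is below [absv x] has the same
    absolute value as [x]; so no new values appear in the completion. *)
Lemma Qp_abs_val x : x != 0 -> exists N : int, absv x = p%:R ^ (- N) :> rat.
Proof.
move=> x0; have ax : 0 < (absv x : rat).
  by rewrite lt0r absv_ge0 andbT; apply: contraNneq x0 => /absv_eq0 ->.
have [q qx] := Qp_rat_dense x ax.
have qE : absv x = padic_abs_rat p q.
  rewrite -absv_Qp_of_rat; apply/eqP; rewrite eq_le; apply/andP; split.
    rewrite leNgt; apply/negP => qlt.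
    by have := Qp_ultra_lt qx qlt; rewrite subrK ltxx.
  rewrite -[Qp_of_rat p_pr q](subrK x); apply: Qp_ultra_le => //.
  by rewrite -absvN opprB ltW.
have q0 : q != 0 by rewrite -(padic_abs_rat_eq0 p_pr) -qE gt_eqF.
by exists (padic_val_rat p q); rewrite qE /padic_abs_rat (negPf q0).
Qed.

Lemma Zp_nat_dense x e : absv x <= 1 -> 0 < e ->
  exists n : nat, absv (x - n%:R) < e.
Proof.
(* A distance below 1 makes the rational approximation p-integral too, so that it can in turn be
   approximated by naturals. *)
move=> x1 e0; have e1 : 0 < Num.min e 1 by rewrite lt_min e0 ltr01.
have [q] := Qp_rat_dense x e1; rewrite lt_min => /andP[qe q1].
have [|n ne] := @padic_rat_approx_nat q e _ e0.
  rewrite -absv_Qp_of_rat -[Qp_of_rat p_pr q](subrK x); apply: Qp_ultra_le => //.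
  by rewrite -absvN opprB ltW.
exists n; rewrite -(subrKA (Qp_of_rat p_pr q)); apply: Qp_ultra_lt => //.
by rewrite -(rmorph_nat (Qp_of_rat p_pr)) -rmorphB absv_Qp_of_rat.
Qed.

Lemma absv_Qp_nat_le1 (n : nat) : absv (n%:R : Qp) <= 1.
Proof.
elim: n => [|n IH]; first by rewrite mulr0n absv0.
by rewrite -addn1 natrD; apply: Qp_ultra_le => //; rewrite absv1.
Qed.

Lemma Qp_natr_inj : injective (fun n : nat => n%:R : Qp).
Proof.
move=> a b; rewrite -!(rmorph_nat (Qp_of_rat p_pr)) => /fmorph_inj /eqP.
by rewrite eqr_nat => /eqP.
Qed.

End PadicAbs.

(** * Newton's forward difference formula *)

Section Newton.
Variables (U V : zmodType) (h : U).

(** Induction on [M] through [fdiff h f], which is killed by one difference fewer, and on [n]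
    through one step of length [h]; Pascal's rule merges the two sums. *)
Lemma newton_forward (M n : nat) (f : U -> V) (x : U) :
    (forall y, iter M (fdiff h) f y = 0) ->
  f (x + h *+ n) = \sum_(i < M) iter i (fdiff h) f x *+ 'C(n, i).
Proof.
elim: M n f x => [|M IHM] n f x f0; first by rewrite big_ord0; exact: f0.
elim: n => [|n IHn].
  rewrite mulr0n addr0 big_ord_recl /= bin0 big1 ?addr0 ?mulr1n //.
have fD y : f (y + h) = f y + fdiff h f y by rewrite /fdiff [RHS]addrC subrK.
rewrite (mulrSr h) addrA fD IHn IHM => [|y]; last by have := f0 y; rewrite iterSr.
rewrite !big_ord_recl !bin0 -addrA; congr (_ + _); rewrite -big_split.
apply: eq_bigr => i _; rewrite /= /bump /= !add1n binS mulrnDr; congr (_ + _ *+ _).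
by rewrite -iterSr.
Qed.

End Newton.

(** * Binomial polynomials, and equality of polynomials in characteristic 0 *)

Section BinomialPoly.
Variable K : fieldType.
Hypothesis natK : forall n : nat, n.+1%:R != 0 :> K.

Definition binpoly (i : nat) : {poly K} :=
  i`!%:R^-1 *: \prod_(j < i) ('X - (j%:R)%:P).

Lemma size_binpoly i : (size (binpoly i) <= i.+1)%N.
Proof.
apply: leq_trans (size_scale_leq _ _) _.
by rewrite size_prod_XsubC /index_enum -enumT size_enum_ord.
Qed.

Lemma horner_binpoly i (n : nat) : (binpoly i).[n%:R] = 'C(n, i)%:R.
Proof.
have fi : i`!%:R != 0 :> K by case: i`! (fact_gt0 i).
rewrite hornerZ horner_prod; apply: (mulfI fi); rewrite mulVKf // -natrM mulnC bin_ffact.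
elim: i {fi} => [|i IH]; first by rewrite big_ord0.
rewrite big_ord_recr /= IH ffactnSr natrM hornerXsubC.
have [ni|ni] := leqP i n; first by rewrite natrB.
by rewrite ffact_small // !mul0r.
Qed.

(** In characteristic 0 the points [c * n%:R] are pairwise distinct, so a nonzero difference [q - r]
    would have more roots than its degree. *)
Lemma poly_eq_on_natr (c : K) (q r : {poly K}) : c != 0 ->
  (forall n : nat, q.[c * n%:R] = r.[c * n%:R]) -> q = r.
Proof.
move=> c0 qr; apply/eqP; rewrite -subr_eq0; apply: contraT => d0.
have [] := ltnP (size [seq c * n%:R | n <- iota 0 (size (q - r))]) (size (q - r)).
  by rewrite size_map size_iota ltnn.
rewrite leqNgt => /negP[]; apply: max_poly_roots => //.
  by apply/allP => _ /mapP[n _ ->]; rewrite rootE hornerD hornerN qr subrr.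
rewrite map_inj_uniq ?iota_uniq // => a b /(mulfI c0).
wlog ab : a b / (a <= b)%N.
  by move=> W e; case: (leqP a b) => [/W|/ltnW/W]; [exact|move/(_ (esym e))].
move=> /esym/eqP; rewrite -subr_eq0 -natrB //.
by case E: (b - a)%N => [|k]; [lia|rewrite (negPf (natK k))].
Qed.

End BinomialPoly.

(** * Difference operators lower the degree of polynomials *)

Lemma size_shift_sub (K : idomainType) (q : {poly K}) (c : K) n :
  (size q <= n.+1)%N -> (size (q \Po ('X + c%:P) - q)%R <= n)%N.
Proof.
move=> qn; have sX : size ('X + c%:P : {poly K}) = 2 by rewrite size_XaddC.
apply/leq_sizeP => j nj; rewrite coefB.
move: nj; rewrite leq_eqVlt => /orP[/eqP<-|nj]; last first.
  by rewrite !nth_default ?subrr ?size_comp_poly2 // (leq_trans qn).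
have [qn1|] := leqP (size q) n.
  by rewrite !nth_default ?subrr ?size_comp_poly2.
move=> nq; have sq : size q = n.+1 by apply/eqP; rewrite eqn_leq qn nq.
(* Composing with ['X + c%:P] keeps the size and the leading coefficient, so the coefficients of
   degree [n] cancel. *)
have := @lead_coef_comp _ q ('X + c%:P); rewrite sX => /(_ isT).
rewrite lead_coefXaddC expr1n mulr1 !lead_coefE size_comp_poly2 // sq /= => ->.
by rewrite subrr.
Qed.

Lemma iter_fdiff_horner (U : nzRingType) (K : idomainType)
    (j : {rmorphism U -> K}) (w : U) n (q : {poly K}) (z : U) :
  (size q <= n)%N -> iter n (fdiff w) (fun z => q.[j z]) z = 0.
Proof.
elim: n q => [|n IH] q; first by rewrite leqn0 size_poly_eq0 => /eqP-> /=; rewrite horner0.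
move=> /size_shift_sub qn; rewrite iterSr -[RHS](IH _ (qn (j w))).
congr (iter n _ _ _); apply/funext => t.
by rewrite /fdiff !hornerE horner_comp !hornerE rmorphD.
Qed.

(** * Continuity between valued fields, possibly with different fields of values *)

Lemma continuous_absvP (R1 R2 : numFieldType) (K1 : valuedFieldType R1)
    (K2 : valuedFieldType R2) (f : K1 -> K2) :
  continuous f <->
  forall x e, 0 < e -> exists d, 0 < d /\
    forall y, absv (x - y) < d -> absv (f x - f y) < e.
Proof.
split=> [cf x e e0|cf x].
  have /cvg_ballP /(_ e e0) /nbhs_ballP [d d0 dP] := cf x.
  by exists d; split=> // y xy; exact: dP.
apply/(@cvg_ballP R2 K2 K1 (nbhs x) (nbhs_filter x)) => e e0; have [d [d0 dP]] := cf x e e0.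
by apply/nbhs_ballP; exists d => // y; exact: dP.
Qed.

Lemma horner_continuous (R : realFieldType) (K : valuedFieldType R) (q : {poly K}) :
  continuous (fun u : K => q.[u]).
Proof.
apply/continuous_absvP => u; elim/poly_ind: q => [|q c IH] e e0.
  by exists 1; split=> // v _; rewrite !horner0 subrr absv0.
have e2 : 0 < e / 2 by rewrite divr_gt0.
have pos1 (a : K) : 0 < absv a + 1 by rewrite ltr_wpDl ?absv_ge0.
have [d [d0 dP]] := IH _ (divr_gt0 e2 (pos1 u)).
(* Within [d1] of [u], [absv q.[v]] stays below [absv q.[u] + 1]; the added 1 also keeps the divisor
   in [d2] positive. *)
have [d1 [d10 d1P]] := IH _ ltr01.
pose d2 := e / 2 / (absv q.[u] + 1).
have d20 : 0 < d2 by rewrite !divr_gt0.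
exists (Num.min d (Num.min d1 d2)); split=> [|v]; first by rewrite !lt_min d0 d10.
rewrite !lt_min => /and3P[vd vd1 vd2]; rewrite !hornerE.
have -> : q.[u] * u + c - (q.[v] * v + c) = (q.[u] - q.[v]) * u + q.[v] * (u - v) by ring.
apply: le_lt_trans (absvD _ _) _; rewrite !absvM [X in _ < X]splitr.
have qv : absv q.[v] <= absv q.[u] + 1.
  rewrite -(subrK q.[u] q.[v]) addrC; apply: le_trans (absvD _ _) _.
  by rewrite lerD2l -absvN opprB ltW // d1P.
apply: ltr_leD.
  rewrite -[X in _ < X](divfK (lt0r_neq0 (pos1 u))).
  apply: (@le_lt_trans _ _ (absv (q.[u] - q.[v]) * (absv u + 1))).
    by rewrite ler_wpM2l ?absv_ge0 // lerDl.
  by rewrite ltr_pM2r ?pos1 // dP.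
rewrite -[X in _ <= X](divfK (lt0r_neq0 (pos1 q.[u]))) mulrC.
by rewrite ler_pM ?absv_ge0 // ltW.
Qed.

(** * Polynomial behaviour along a period, and stability of periods under Z_p *)

Section Periods.
Variables (p : nat) (p_pr : prime p) (m : nat) (R : realType).
Variables (K : valuedFieldType R) (j : {rmorphism Qp p_pr -> K}).
Hypothesis j_cont : continuous (j : Qp p_pr -> K).
Local Notation Qp := (Qp p_pr).
Implicit Types (f : Qp -> K) (h x z : Qp).

Lemma Qp_natS_neq0 (n : nat) : n.+1%:R != 0 :> K.
Proof.
rewrite -(rmorph_nat j) fmorph_eq0 -[0]/(0%:R : Qp); apply/eqP => /Qp_natr_inj.
by [].
Qed.

Lemma horner_rmorph_continuous (q : {poly K}) : continuous (fun x => q.[j x]).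
Proof.
move=> x; have qc := @horner_continuous R K q (j x).
exact: (continuous_comp (@j_cont x) qc).
Qed.

(** The naturals are dense in Z_p: at a natural close to [z] the two functions agree, which by
    continuity contradicts a positive gap at [z]. *)
Lemma eq_on_nat_Zp (f g : Qp -> K) : continuous f -> continuous g ->
  (forall n : nat, f n%:R = g n%:R) ->
  forall z, absv z <= 1 -> f z = g z.
Proof.
move=> /continuous_absvP cf /continuous_absvP cg fg z z1.
apply: absv_dist_eq0; apply/eqP; apply: contraT => d0.
set e := absv (f z - g z) in d0.
have e2 : 0 < e / 2 by rewrite divr_gt0 // lt0r d0 absv_ge0.
have [d1 [d10 P1]] := cf z _ e2; have [d2 [d20 P2]] := cg z _ e2.
have [|n] := @Zp_nat_dense p p_pr z (Num.min d1 d2) z1.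
  by rewrite lt_min d10.
rewrite lt_min => /andP[n1 n2].
have : e < e; last by rewrite ltxx.
rewrite {1}/e -(subrKA (f n%:R)) (le_lt_trans (absvD _ _)) //.
by rewrite [X in _ < X]splitr ltrD ?P1 // fg absv_distC P2.
Qed.

Lemma affine_continuous x h : continuous (fun z : Qp => x + h * z).
Proof.
apply/continuous_absvP => y e e0.
have h1 : 0 < absv h + 1 :> rat by rewrite ltr_wpDl ?absv_ge0.
exists (e / (absv h + 1)); split=> [|z]; first by rewrite divr_gt0.
rewrite ltr_pdivlMr // => yz.
have -> : x + h * y - (x + h * z) = h * (y - z) by ring.
by rewrite absvM mulrC; apply: le_lt_trans yz; rewrite ler_wpM2l ?absv_ge0 ?lerDl.
Qed.

Lemma poly_on_period_coset f h x : continuous f -> poly_periods m f h ->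
  exists q : {poly K}, (size q <= m.+1)%N /\
    forall z, absv z <= 1 -> f (x + h * z) = q.[j z].
Proof.
move=> cf hP.
(* By Newton's formula this polynomial takes the value [f (x + h * n%:R)] at every natural [n];
   density extends the equality to Z_p. *)
exists (\sum_(i < m.+1) iter i (fdiff h) f x *: binpoly K i); split.
  apply: leq_trans (size_sum _ _ _) _; apply/bigmax_leqP => i _.
  by apply: leq_trans (size_scale_leq _ _) _; apply: leq_trans (size_binpoly _ _) _.
apply: eq_on_nat_Zp => [||n].
- by move=> z; apply: (@continuous_comp _ _ _ (fun z => x + h * z)); [exact: affine_continuous|exact: cf].
- exact: horner_rmorph_continuous.
rewrite mulr_natr (newton_forward _ _ hP) rmorph_nat horner_sum.
apply: eq_bigr => i _.
by rewrite hornerZ (horner_binpoly Qp_natS_neq0) mulr_natr.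
Qed.

(** On [x + h Z_p] the function is a polynomial of degree at most [m] in [z], and a step [h * w] of
    [f] is a step [w] of [z], which stays in Z_p. *)
Lemma poly_periodsM f h w : continuous f -> poly_periods m f h ->
  absv w <= 1 -> poly_periods m f (h * w).
Proof.
move=> cf hP w1 x; have [q [qm fq]] := poly_on_period_coset x cf hP.
have key n z : absv z <= 1 ->
    iter n (fdiff (h * w)) f (x + h * z) = iter n (fdiff w) (fun z => q.[j z]) z.
  elim: n z => [|n IH] z z1; first exact: fq.
  by rewrite /= /fdiff -addrA -mulrDr !IH // Qp_ultra_le.
(* Since [x] is arbitrary, evaluating at [z = 0] is enough. *)
rewrite -[x]addr0 -(mulr0 h) key ?absv0 //.
exact: iter_fdiff_horner.
Qed.

Lemma poly_periods_ball f h h' : continuous f -> poly_periods m f h ->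
  absv h' <= absv h -> poly_periods m f h'.
Proof.
move=> cf hP hh; have [h0|h0] := eqVneq h 0.
  move: hh; rewrite h0 absv0 => hh; suff -> : h' = h by [].
  by rewrite h0; apply/absv_eq0/eqP; rewrite eq_le hh absv_ge0.
have ah : 0 < absv h :> rat.
  by rewrite lt0r absv_ge0 andbT; apply: contraNneq h0 => /absv_eq0 ->.
rewrite -(divfK h0 h') mulrC; apply: poly_periodsM => //.
by rewrite -(ler_pM2r ah) -absvM divfK // mul1r.
Qed.

(** * Classification of the sets of periods, and polynomials on their cosets *)

Lemma pball_absv (N : int) :
  [set p%:R ^ N * z | z in Zp_in_Qp p_pr] = [set x | absv x <= p%:R ^ (- N)].
Proof.
have pN : 0 < p%:R ^ (- N) :> rat by rewrite exprz_gt0 // ltr0n prime_gt0.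
have pN0 : p%:R ^ N != 0 :> Qp by rewrite expfz_neq0 ?Qp_natp_neq0.
apply/seteqP; split=> [_ [z z1 <-]|x xN] /=.
  by rewrite absvM absv_Qp_expz ger_pMr.
exists (x / p%:R ^ N); last by rewrite mulrC divfK.
by rewrite /Zp_in_Qp /= -(ler_pM2r pN) -absv_Qp_expz -absvM divfK // mul1r absv_Qp_expz.
Qed.

Lemma poly_periods0 f : poly_periods m f 0.
Proof. by move=> x; rewrite iterS /fdiff addr0 subrr. Qed.

Lemma poly_periods_unbounded f : continuous f ->
  (forall M : rat, exists2 h, poly_periods m f h & M < absv h) ->
  poly_periods m f = setT.
Proof.
move=> cf unb; apply/seteqP; split=> // x _.
by have [h hP /ltW] := unb (absv x); exact: poly_periods_ball.
Qed.

(** If the periods are bounded and not all zero, discreteness of the value group yields a period of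
    largest absolute value, and the periods fill the closed ball of that radius. *)
Lemma poly_periods_trichotomy f : continuous f ->
  [\/ poly_periods m f = [set 0], poly_periods m f = setT
    | exists N : int, poly_periods m f = [set p%:R ^ N * z | z in Zp_in_Qp p_pr]].
Proof.
move=> cf; have [unb|] := pselect (forall M : rat, exists2 h, poly_periods m f h & M < absv h).
  by apply: Or32; exact: poly_periods_unbounded.
move=> /existsNP[M /forall2NP bnd].
have {}bnd h : poly_periods m f h -> absv h <= M.
  by move=> hP; case: (bnd h) => // /negP; rewrite -leNgt.
have [all0|] := pselect (forall h, poly_periods m f h -> h = 0).
  apply: Or31; apply/seteqP; split=> [h /all0 //|_ ->]; exact: poly_periods0.
move=> /existsNP[h0 /not_implyP[h0P /eqP h00]]; apply: Or33.
have p1 : 1 < p%:R :> rat by rewrite ltr1n prime_gt1.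
have [N0 N0E] := Qp_abs_val h00.
(* Exponents are counted from that of [h0], so that the maximum is sought over naturals, with
   [k = 0] realised by [h0]. *)
pose P (k : nat) := `[< exists2 h, poly_periods m f h & absv h = p%:R ^ (k%:Z - N0) :> rat >].
have exP : exists k, P k by exists 0%N; apply/asboolP; exists h0; rewrite // sub0r.
have [b bP] : exists b : nat, forall k, P k -> (k <= b)%N.
  have M0 : 0 < M.
    apply: lt_le_trans (bnd _ h0P).
    by rewrite lt0r absv_ge0 andbT; apply: contraNneq h00 => /absv_eq0 ->.
  have pN0 : 0 < p%:R ^ (- N0) :> rat by rewrite exprz_gt0 // ltr0n prime_gt0.
  (* This choice of [b] means [M < p ^ (b - N0)], so larger exponents would exceed the bound [M] on
     periods. *)
  have [b] := prime_expV_lt p_pr (divr_gt0 pN0 M0).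
  rewrite ltr_pdivlMr // mulrC ltr_pdivrMr ?exprn_gt0 ?ltr0n ?prime_gt0 //.
  rewrite exprnP -expfzDr ?gt_eqF ?ltr0n ?prime_gt0 // => bM.
  exists b => k /asboolP[h /bnd hM hE]; rewrite leqNgt; apply/negP => bk.
  have : M < M; last by rewrite ltxx.
  apply: lt_le_trans bM (le_trans _ hM).
  by rewrite hE ler_eXz2l //; lia.
have [k /asboolP[h hP hE] kmax] := ex_maxnP exP bP.
exists (N0 - k%:Z); rewrite pball_absv opprB -hE.
apply/seteqP; split=> [x xP|x] /=; last exact: poly_periods_ball.
rewrite leNgt; apply/negP => hx.
have x0 : x != 0.
  by apply: contraTneq hx => ->; rewrite absv0 -leNgt absv_ge0.
have [N NE] := Qp_abs_val x0; move: hx; rewrite hE NE ltr_eXz2l // => lt1.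
(* A period [x] outside the ball has [N0 - N > k >= 0], an index contradicting the maximality of
   [k]. *)
have xk : P `|(N0 - N)%R|%N.
  by apply/asboolP; exists x => //; rewrite NE; congr (_ ^ _); lia.
by have := kmax _ xk; lia.
Qed.

(** One nonzero period [h0] determines the polynomial: the one obtained on any larger ball agrees
    with it at the infinitely many points [h0 * n%:R], hence equals it. *)
Lemma poly_on_periods f (a : Qp) : continuous f ->
  exists q : {poly K}, (size q <= m.+1)%N /\
    forall x, [set a + h | h in poly_periods m f] x -> f x = q.[j x].
Proof.
move=> cf.
suff [q [qm qE]] : exists q : {poly K}, (size q <= m.+1)%N /\
    forall h, poly_periods m f h -> f (a + h) = q.[j h].
  exists (q \Po ('X + (- j a)%:P)); split; first by rewrite size_comp_poly2 // size_XaddC.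
  by move=> _ [h /qE fh <-]; rewrite fh horner_comp !hornerE rmorphD addrC addKr.
have [all0|] := pselect (forall h, poly_periods m f h -> h = 0).
  (* When 0 is the only period, the coset is the single point [a] and a constant suffices. *)
  exists (f a)%:P; split; first by apply: leq_trans (size_polyC_leq1 _) _.
  by move=> h /all0 ->; rewrite addr0 hornerC.
move=> /existsNP[h0 /not_implyP[h0P /eqP h00]].
have loc h : poly_periods m f h -> h != 0 -> exists q : {poly K}, (size q <= m.+1)%N /\
    forall x, absv x <= absv h -> f (a + x) = q.[j x].
  move=> hP hn0; have [q [qm qE]] := poly_on_period_coset a cf hP.
  have jh : (j h)^-1 != 0 by rewrite invr_eq0 fmorph_eq0.
  (* The variable of [q] is the quotient by [h], so it is rescaled to recover [x] itself. *)
  exists (q \Po ((j h)^-1 *: 'X)); split.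
    by rewrite size_comp_poly2 // size_scale // size_polyX.
  move=> x xh; rewrite horner_comp hornerZ hornerX mulrC -fmorph_div -qE.
    by rewrite mulrC divfK.
  have ah : 0 < absv h :> rat.
    by rewrite lt0r absv_ge0 andbT; apply: contraNneq hn0 => /absv_eq0 ->.
  by rewrite -(ler_pM2r ah) -absvM divfK // mul1r.
have [q [qm qE]] := loc _ h0P h00; exists q; split=> // h hP.
have [hle|/ltW hle] := leP (absv h : rat) (absv h0); first exact: qE.
have hn0 : h != 0.
  apply: contra_neq h00 => hz; apply/absv_eq0/eqP.
  by rewrite eq_le absv_ge0 andbT; move: hle; rewrite hz absv0.
have [r [rm rE]] := loc _ hP hn0.
suff -> : q = r by exact: rE.
apply: (poly_eq_on_natr Qp_natS_neq0 (c := j h0)) => [|n]; first by rewrite fmorph_eq0.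
have nle : absv (h0 * n%:R) <= absv h0 :> rat.
  by rewrite absvM ler_piMr //; [exact: absv_ge0|exact: absv_Qp_nat_le1].
rewrite -(rmorph_nat j) -rmorphM -qE // -rE //; exact: le_trans nle hle.
Qed.

(** * Functions attaining each case *)

Lemma poly_periods_horner (q : {poly K}) : (size q <= m.+1)%N ->
  poly_periods m (fun x => q.[j x]) = setT.
Proof.
by move=> qm; apply/seteqP; split=> // h _ x; exact: iter_fdiff_horner.
Qed.

(** A nonzero period [h] would make ['X^(m.+1)] coincide on all [h * n%:R] with a polynomial of
    degree at most [m]. *)
Lemma poly_periods_Xn :
  poly_periods m (fun x => ('X^(m.+1) : {poly K}).[j x]) = [set 0].
Proof.
set f := fun x => _; have cf : continuous f by exact: horner_rmorph_continuous.
apply/seteqP; split=> [h hP /=|_ ->]; last exact: poly_periods0.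
apply/eqP; apply: contraT => h0; have [q [qm qE]] := poly_on_periods 0 cf.
have qX : q = 'X^(m.+1).
  apply: (poly_eq_on_natr Qp_natS_neq0 (c := j h)) => [|n]; first by rewrite fmorph_eq0.
  rewrite -(rmorph_nat j) -rmorphM -qE //; exists (h * n%:R); rewrite ?add0r //.
  by apply: poly_periodsM => //; exact: absv_Qp_nat_le1.
by move: qm; rewrite qX size_polyXn ltnn.
Qed.

(** Balls are clopen: two points at distance below [c] lie both inside or both outside, so the
    indicator is locally constant. *)
Lemma absv_le_indic_continuous (c : rat) : 0 < c ->
  continuous (fun x => (absv x <= c)%R%:R : K).
Proof.
move=> c0; apply/continuous_absvP => x e e0; exists c; split=> // y /ltW xy.
suff -> : (absv x <= c) = (absv y <= c) by rewrite subrr absv0.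
apply/idP/idP => [xc|yc].
  by rewrite -(subrK x y); apply: Qp_ultra_le; rewrite // absv_distC.
by rewrite -(subrK y x); exact: Qp_ultra_le.
Qed.

(** Shifts by the ball fix its indicator, so the ball consists of periods. Conversely, the
    polynomial given by [poly_on_periods] is 1 on the ball, hence everywhere, and [f h = 1] puts
    each period [h] in the ball. *)
Lemma poly_periods_indic (N : int) :
  poly_periods m (fun x => (absv x <= p%:R ^ (- N) :> rat)%R%:R : K) =
  [set x | absv x <= p%:R ^ (- N)].
Proof.
set c := p%:R ^ (- N); set f := fun x => _.
have c0 : 0 < c by rewrite exprz_gt0 // ltr0n prime_gt0.
have cf : continuous f by exact: absv_le_indic_continuous.
have sub h : absv h <= c -> poly_periods m f h.
  (* A single difference already gives the zero function, seen as the polynomial 0 so that the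
     remaining [m] differences vanish. *)
  move=> hc x; rewrite iterSr -[RHS](@iter_fdiff_horner _ _ j h m 0 x) ?size_poly0 //.
  congr (iter _ _ _ _); apply/funext => y; rewrite horner0 /fdiff /f.
  suff -> : (absv (y + h) <= c) = (absv y <= c) by rewrite subrr.
  apply/idP/idP => yc; last exact: Qp_ultra_le.
  by rewrite -(addrK h y); apply: Qp_ultra_le; rewrite // absvN.
apply/seteqP; split=> [h hP|h] /=; last exact: sub.
have [q [_ qE]] := poly_on_periods 0 cf.
have q1 : q = 1.
  have pN0 : p%:R ^ N != 0 :> Qp by rewrite expfz_neq0 ?Qp_natp_neq0.
  apply: (poly_eq_on_natr Qp_natS_neq0 (c := j (p%:R ^ N))) => [|n].
    by rewrite fmorph_eq0.
  have nc : absv (p%:R ^ N * n%:R : Qp) <= c.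
    by rewrite absvM absv_Qp_expz ler_piMr ?(ltW c0) ?absv_Qp_nat_le1.
  rewrite -(rmorph_nat j) -rmorphM -qE; first by rewrite /f nc hornerC.
  by exists (p%:R ^ N * n%:R); rewrite ?add0r //; exact: sub.
have : f h = 1 by rewrite qE ?q1 ?hornerC //; exists h; rewrite ?add0r.
by rewrite /f; case: (_ <= _) => // /esym/eqP; rewrite oner_eq0.
Qed.

End Periods.

(** * Shape of the period sets and the criterion for polynomials *)

Theorem theorem2p4 (p : nat) (p_pr : prime p) (m : nat)
    (R : realType) (K : valuedFieldType R)
    (iota : {rmorphism Qp p_pr -> K}) (iota_cont : continuous (iota : Qp p_pr -> K)) :
  [/\
      forall f : Qp p_pr -> K, continuous f ->
        [\/ poly_periods m f = [set 0],
            poly_periods m f = setT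
          | exists N : int,
              poly_periods m f = [set p%:R ^ N * z | z in Zp_in_Qp p_pr]],
     
      [/\ exists f : Qp p_pr -> K, continuous f /\ poly_periods m f = [set 0],
          exists f : Qp p_pr -> K, continuous f /\ poly_periods m f = setT
        & forall N : int, exists f : Qp p_pr -> K, continuous f /\
            poly_periods m f = [set p%:R ^ N * z | z in Zp_in_Qp p_pr]],
     
      forall f : Qp p_pr -> K, continuous f -> forall a : Qp p_pr,
        exists c : 'I_m.+1 -> K,
          forall x, [set a + h | h in poly_periods m f] x ->
            f x = \sum_(i < m.+1) c i * iota x ^+ i
    &
      forall f : Qp p_pr -> K, continuous f ->
        (exists c : 'I_m.+1 -> K,
           forall x, f x = \sum_(i < m.+1) c i * iota x ^+ i)
        <->
        (exists u : nat -> Qp p_pr,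
           (forall n, poly_periods m f (u n)) /\
           (forall M : rat, exists n, M < absv (u n)))].
Proof.
have coefs f a : continuous f -> exists c : 'I_m.+1 -> K,
    forall x, [set a + h | h in poly_periods m f] x ->
      f x = \sum_(i < m.+1) c i * iota x ^+ i.
  move=> cf; have [q [qm qE]] := poly_on_periods m iota_cont a cf.
  by exists (fun i => q`_i) => x /qE ->; exact: horner_coef_wide.
split.
- by move=> f cf; exact: (poly_periods_trichotomy m iota_cont cf).
- split.
  + exists (fun x => ('X^(m.+1) : {poly K}).[iota x]).
    by split; [exact: horner_rmorph_continuous|exact: poly_periods_Xn].
  + exists (fun x => (0 : {poly K}).[iota x]).
    split; [exact: horner_rmorph_continuous|apply: poly_periods_horner].
    by rewrite size_poly0.
  + move=> N; exists (fun x => (absv x <= p%:R ^ (- N) :> rat)%R%:R).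
    split; last by rewrite pball_absv; exact: (poly_periods_indic m iota_cont).
    by apply: absv_le_indic_continuous; rewrite exprz_gt0 // ltr0n prime_gt0.
- by move=> f cf a; exact: coefs.
move=> f cf; split=> [[c fE]|[u [uP unb]]].
  pose q : {poly K} := \poly_(i < m.+1) c (inord i).
  have -> : f = fun x => q.[iota x].
    apply/funext => x; rewrite fE horner_poly.
    by apply: eq_bigr => i _; rewrite inord_val.
  rewrite poly_periods_horner ?size_poly //.
  (* The powers [p ^ (- n)] have absolute value [p ^ n], and every p-adic number is a period
     here. *)
  exists (fun n => p%:R ^ (- n%:Z)); split=> // M.
  have M1 : 0 < `|M| + 1 by rewrite ltr_wpDl.
  have [n] := prime_expV_lt p_pr (eqbRL (invr_gt0 _) M1).
  rewrite ltf_pV2 ?posrE ?exprn_gt0 ?ltr0n ?prime_gt0 // => Mn.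
  exists n; rewrite absv_Qp_expz opprK -exprnP; apply: lt_trans Mn.
  by rewrite (le_lt_trans (ler_norm M)) // ltrDl.
have PT : poly_periods m f = setT.
  apply: (poly_periods_unbounded iota_cont cf) => M.
  by have [n Mn] := unb M; exists (u n).
(* All of [Qp] being periods, the coset of 0 is the whole field. *)
have [c cE] := coefs f 0 cf; exists c => x; apply: cE.
by exists x; rewrite ?PT ?add0r.
Qed.
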